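(* Let $q$ be a prime power and let $u,v\in\mathbb{F}_{q^3}^*$ with $\mathrm{N}_{q^3/q}(-v/u)\neq1$. Let $\mathcal{B}=\{x\in\mathbb{F}_{q^3}:\mathrm{Tr}_{q^3/q}(u^{q^2}v^qx)=u^{q^2+q+1}+v^{q^2+q+1}\}$. Then for every $\beta\in\mathcal{B}$ the equation $ux^{q^2-1}+vx^{q-1}+\beta=0$ has no solution $x\in\mathbb{F}_{q^3}^*$. Moreover, for any $\theta\in\mathcal{B}$ and $a\in\mathbb{F}_{q^3}^*$, letting $L(X)=u^{q^2}v^q\bigl(ua^{q^2-1}X^{q^2}+va^{q-1}X^q+\theta X\bigr)$, the polynomial $\mathrm{Tr}_{q^3/q}(L(X)/X)$ has no root in $\mathbb{F}_{q^3}^*$.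
   Context: $\mathrm{Tr}_{q^3/q}$ and $\mathrm{N}_{q^3/q}$ denote the trace and norm maps from $\mathbb{F}_{q^3}$ to $\mathbb{F}_q$. *)

(* Defs.v *)
From HB Require Import structures.
From mathcomp Require Export all_boot all_order all_algebra all_fingroup.
From mathcomp Require Export all_solvable all_field.

Set Implicit Arguments.
Unset Strict Implicit.
Unset Printing Implicit Defensive.

Import GRing.Theory.
Local Open Scope ring_scope.

Section Defs.

(* [K] plays the role of F_q (so q = #|K|) and [L] that of F_(q^3), once
   [\dim {:L} = 3] is assumed.  Every finite extension of a finite field is
   normal, so asking for a [splittingFieldType] is no restriction (see
   [FinSplittingFieldType]). *)
Variables (K : finFieldType) (L : splittingFieldType K).
Implicit Types (u v a b x : L) (P : {poly L}).

Definition Tr x : L := galTrace 1%AS {:L}%AS x.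
Definition Nm x : L := galNorm 1%AS {:L}%AS x.

Definition in_B (q : nat) u v : pred L := fun x =>
  Tr (u ^+ (q ^ 2) * v ^+ q * x)
    == u ^+ (q ^ 2 + q + 1) + v ^+ (q ^ 2 + q + 1).

Definition Lpoly (q : nat) u v a b : {poly L} :=
  (u ^+ (q ^ 2) * v ^+ q) *:
    ((u * a ^+ (q ^ 2 - 1)) *: 'X^(q ^ 2) + (v * a ^+ (q - 1)) *: 'X^q
     + b *: 'X).

(* Tr applied to a polynomial, P + P^q + P^(q^2); it evaluates to the field
   trace of the value of P, see [horner_Trpoly]. *)
Definition Trpoly (q : nat) P : {poly L} := P + P ^+ q + P ^+ (q ^ 2).

Lemma TrE x : \dim {:L} = 3 -> Tr x = x + x ^+ #|K| + x ^+ (#|K| ^ 2).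
Proof.
move=> dimL.
have sub1 : (1%AS <= {:L}%AS)%VS by apply: sub1v.
have [s gen_s Ds] := finField_galois_generator sub1.
have Dsx y : s y = y ^+ #|K| by rewrite Ds ?memvf //= dimv1 expn1.
have galG := finField_galois sub1.
have cardG := galois_dim galG.
rewrite dimv1 divn1 dimL in cardG.
have DG := eqP gen_s.
have os : #[s]%g = 3 by rewrite /order -DG -cardG.
rewrite /Tr /galTrace DG.
rewrite (eq_bigl [in [set (s ^+ i)%g | i : 'I_3]]); last first.
  move=> y; apply/cycleP/imsetP => [[i ->]|[i _ ->]]; last by exists i.
  exists (inord (i %% 3)) => //.
  by rewrite inordK ?ltn_mod // -(expg_mod_order s i) os.
rewrite big_imset /=; last first.
  move=> i j _ _ /eqP; rewrite eq_expg_mod_order os !modn_small ?ltn_ord //.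
  by move/eqP/val_inj.
rewrite !big_ord_recl big_ord0 addr0 /= /bump /= addrA expg0 expg1.
rewrite gal_id Dsx; congr (_ + _ + _).
by rewrite expgS expg1 galM ?memvf // !Dsx -exprM mulnn.
Qed.

Lemma horner_Trpoly P x :
  \dim {:L} = 3 -> (Trpoly #|K| P).[x] = Tr P.[x].
Proof. by move=> /TrE->; rewrite /Trpoly !hornerE. Qed.

End Defs.

(* Main.v *)
From mathcomp Require Import ring.
Require Import Defs.

(** Write [z'] for [z ^ q]. If [y] is nonzero and [b] lies in [B], then
    [Tr (u'' v' (u y^(q^2-1) + v y^(q-1) + b))] is, after expansion, exactly the
    product of the three conjugates of [u y'' / y' + v], i.e. its norm.
    If it vanishes then [-v/u = y'' / y'], which has norm 1, against the
    hypothesis. The first claim is the case where the argument of the trace is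
    zero; in the second, [L(x)/x] is this argument at [y = a x]. *)

Import GRing.Theory.
Local Open Scope ring_scope.

Lemma expf_subn1 (F : fieldType) (y : F) n :
  y != 0 -> (0 < n)%N -> y ^+ (n - 1) = y ^+ n / y.
Proof. by case: n => // n y0 _; rewrite subn1 exprSr mulfK. Qed.

Lemma horner_divpX (F : fieldType) (P : {poly F}) x :
  root P 0 -> x != 0 -> (P %/ 'X).[x] = P.[x] / x.
Proof.
move=> P0 x0; have dvdXP : 'X %| P by rewrite -(subr0 'X) -polyC0 dvdp_XsubCl.
by rewrite -{2}(divpK dvdXP) hornerM hornerX mulfK.
Qed.

(** The conjugates are independent variables here, with the rule [z''' = z] already applied, so only
    a rational identity remains. The last summand on the left is the value of [Tr (u'' v' b)] for
    [b] in B. *)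
Lemma trace_sum_eq_norm (F : fieldType) (u u' u'' v v' v'' y y' y'' : F) :
  y != 0 -> y' != 0 -> y'' != 0 ->
  u'' * v' * (u * (y'' / y) + v * (y' / y))
  + u * v'' * (u' * (y / y') + v' * (y'' / y'))
  + u' * v * (u'' * (y' / y'') + v'' * (y / y''))
  + (u * u' * u'' + v * v' * v'')
  = (u * (y'' / y') + v) * (u' * (y / y'') + v') * (u'' * (y' / y) + v'').
Proof. by move=> y0 y'0 y''0; field; rewrite y0 y'0 y''0. Qed.

Section CubicExtension.

Variables (K : finFieldType) (L : splittingFieldType K).
Hypothesis dimL : \dim {:L} = 3%N.
Local Notation q := #|K|.
Implicit Types u v x y b : L.

(** Seeing the [q]-th power as a Galois generator yields both its additivity and access to Hilbert
    90. *)
Lemma Frobenius_generator :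
  exists2 s, generator 'Gal({:L} / 1%AS) s & forall x, s x = x ^+ q.
Proof.
have [s gen_s Ds] := finField_galois_generator (sub1v {:L}%AS).
by exists s => // x; rewrite Ds ?memvf //= dimv1 expn1.
Qed.

Lemma expq_add x y : (x + y) ^+ q = x ^+ q + y ^+ q.
Proof. by have [s _ Ds] := Frobenius_generator; rewrite -!Ds rmorphD. Qed.

Lemma expq3 x : x ^+ q ^+ q ^+ q = x.
Proof.
apply/eqP; rewrite -!exprM mulnn -expnS -dimL.
by rewrite -Fermat's_little_theorem memvf.
Qed.

Lemma TrD x y : Tr (x + y) = Tr x + Tr y.
Proof. exact: raddfD. Qed.

Lemma Nm_expq_div y : y != 0 -> Nm (y ^+ q / y) = 1.
Proof.
move=> y0; have [s gen_s Ds] := Frobenius_generator.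
apply/eqP/(Hilbert's_theorem_90 gen_s (memvf _)).
(* Hilbert 90 expects the form [w / s w], hence the inverse: take [w = y^-1]. *)
by exists y^-1; rewrite ?memvf ?invr_eq0 // Ds exprVn invrK mulrC.
Qed.

Lemma Tr_neq0 u v b y :
  u != 0 -> Nm (- v / u) != 1 -> in_B q u v b -> y != 0 ->
  Tr (u ^+ (q ^ 2) * v ^+ q
      * (u * y ^+ (q ^ 2 - 1) + v * y ^+ (q - 1) + b)) != 0.
Proof.
move=> u0 Nvu /eqP Bb y0; apply/eqP => Tr0.
have q_gt0 : (0 < q)%N by apply/card_gt0P; exists 0.
have y'0 : y ^+ q != 0 by rewrite expf_neq0.
have y''0 : y ^+ q ^+ q != 0 by rewrite expf_neq0.
have factor0 : u * (y ^+ q ^+ q / y ^+ q) + v = 0.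
  set z := _ + v.
  have Dz1 : z ^+ q = u ^+ q * (y / y ^+ q ^+ q) + v ^+ q.
    by rewrite /z expq_add !(exprMn, exprVn) expq3.
  have Dz2 : z ^+ q ^+ q = u ^+ q ^+ q * (y ^+ q / y) + v ^+ q ^+ q.
    by rewrite Dz1 expq_add !(exprMn, exprVn) expq3.
  have : z * z ^+ q * z ^+ q ^+ q = 0.
    rewrite Dz2 Dz1 -trace_sum_eq_norm // -[RHS]Tr0.
    rewrite [in RHS]mulrDr TrD Bb TrE //.
    rewrite !expf_subn1 ?expn_gt0 ?q_gt0 //.
    (* Powers [q ^ 2] become iterated [q]-th powers, so that [expq3] can reduce them. *)
    rewrite !(exprD, expr1, =^~ mulnn, exprM).
    rewrite !(expq_add, exprMn, exprVn, expq3).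
    by congr (_ + _ + _ + _); ring.
  (* All three factors are positive powers of [z], so [z] itself vanishes. *)
  by move/eqP; rewrite !mulf_eq0 !expf_eq0 q_gt0 !orbb => /eqP.
(* Hilbert 90 is applied at [y ^+ q], since [y'' / y'] is its [q]-th power divided by itself. *)
case/eqP: Nvu; rewrite -(Nm_expq_div _ y'0); congr Nm.
move/eqP: factor0; rewrite addrC addr_eq0 => /eqP->.
by rewrite opprK mulrC mulKf.
Qed.

Lemma horner_Lpoly_divX u v a b x :
  x != 0 ->
  (Lpoly q u v a b %/ 'X).[x] =
    u ^+ (q ^ 2) * v ^+ q
    * (u * (a * x) ^+ (q ^ 2 - 1) + v * (a * x) ^+ (q - 1) + b).
Proof.
move=> x0; have q_gt0 : (0 < q)%N by apply/card_gt0P; exists 0.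
rewrite horner_divpX //; last first.
  rewrite /root /Lpoly !hornerE !expr0n expn_eq0 eqn0Ngt q_gt0 /=.
  by rewrite !mulr0 !addr0 mulr0.
(* Only powers of [x] are turned into quotients, as [a] may be zero here. *)
rewrite /Lpoly !hornerE !exprMn !(@expf_subn1 _ x) ?expn_gt0 ?q_gt0 //.
by field.
Qed.

End CubicExtension.

Theorem theorem3p7 (p k q : nat) (K : finFieldType) (L : splittingFieldType K)
    (p_prime : prime p) (k_gt0 : (0 < k)%N) (q_pp : q = (p ^ k)%N)
    (card_K : #|K| = q) (dim_L : \dim {:L} = 3%N)
    (u v : L) (u_neq0 : u != 0) (v_neq0 : v != 0)
    (norm_neq1 : Nm (- v / u) != 1) :
  (forall b : L, in_B q u v b ->
     ~ exists x : L,
         x != 0 /\ u * x ^+ (q ^ 2 - 1) + v * x ^+ (q - 1) + b = 0)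
  /\
  (forall t a : L, in_B q u v t -> a != 0 ->
     ~ exists x : L,
         x != 0 /\ root (Trpoly q (Lpoly q u v a t %/ 'X)) x).
Proof.
subst q; rewrite -card_K; split=> [b Bb [x [x0 eq0]] | t a Bt a0 [x [x0]]].
  have := Tr_neq0 _ _ dim_L _ _ _ _ u_neq0 norm_neq1 Bb x0.
  by rewrite eq0 mulr0 /Tr raddf0 eqxx.
rewrite /root horner_Trpoly // horner_Lpoly_divX //; apply/negP.
by apply: Tr_neq0 => //; rewrite mulf_neq0.
Qed.
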